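(* Let $\mathbb{F}_q$ be a finite field with $q$ elements and characteristic $p$, let $\psi$ be a non-trivial additive character of $\mathbb{F}_q$ (with values in $\mathbb{Q}(\zeta_p)$, $\zeta_p$ a primitive $p$-th root of unity), and set $\psi_m := \psi \circ \mathrm{Tr}_{\mathbb{F}_{q^m}/\mathbb{F}_q}$. Let $f, g \in \mathbb{F}_q[x]$ be coprime polynomials such that the rational function $f/g$ has a pole at $0$ and at infinity (i.e. $g(0) = 0$ and $\deg f > \deg g$), and such that the order of every pole of $f/g$ is not divisible by $p$. Let $n$ be the number of distinct roots of $g$ in an algebraic closure of $\mathbb{F}_q$. For $m \ge 1$ put \[ S_m(f/g) := \sum_{\bar x \in \mathbb{F}_{q^m},\ g(\bar x) \neq 0} \psi_m\big(f(\bar x)/g(\bar x)\big), \qquad L(f/g, T) := \exp\Big(\sum_{m\ge 1} S_m(f/g)\frac{T^m}{m}\Big). \] Assume $p > n$ and that every root of $g$ lies in $\mathbb{F}_q$. Then every $p$-adic unit reciprocal root $\eta$ of $L(f/g,T)$ (i.e. every $\eta$ with $|\eta|_p = 1$ occurring in the factorization $L(f/g,T) = \prod_j (1 - \eta_j T)$) is a 1-unit, i.e. satisfies $|\eta - 1|_p < 1$.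
   Context: It is known (and may be used) that under the stated hypotheses on $f/g$, $L(f/g,T)$ is a polynomial in $T$ with coefficients in $\mathbb{Z}[\zeta_p]$, of degree $\deg(f) + n - 1$, having exactly $n$ reciprocal roots that are $p$-adic units. Here $|\cdot|_p$ is the $p$-adic absolute value extended to an algebraic closure of $\mathbb{Q}_p$. *)

(* Defs.v *)
From HB Require Import structures.
From mathcomp Require Import all_boot all_order all_algebra all_fingroup all_field.
From mathcomp Require Import reals.

Set Implicit Arguments.
Unset Strict Implicit.
Unset Printing Implicit Defensive.

Import Order.TTheory GRing.Theory Num.Theory.

Local Open Scope ring_scope.

Definition padic_abs (R : realType) (p : nat) (x : rat) : R :=
  if x == 0 then 0
  else p%:R ^+ logn p `|denq x|%N / p%:R ^+ logn p `|numq x|%N.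

Definition ultrametric_abs (R : realType) (K : fieldType) (v : K -> R) : Prop :=
  [/\ forall x, 0 <= v x,
      forall x, v x = 0 <-> x = 0,
      forall x y, v (x * y) = v x * v y &
      forall x y, v (x + y) <= Num.max (v x) (v y)].

Definition cauchy_for (R : realType) (K : fieldType) (v : K -> R) (u : nat -> K) :=
  forall eps : R, 0 < eps -> exists N : nat,
    forall i k : nat, (N <= i)%N -> (N <= k)%N -> v (u i - u k) < eps.

Definition converges_for (R : realType) (K : fieldType)
    (v : K -> R) (u : nat -> K) (l : K) :=
  forall eps : R, 0 < eps -> exists N : nat,
    forall i : nat, (N <= i)%N -> v (u i - l) < eps.

(* [(K, v)] is the completion of the rationals for the p-adic absolute value,
   that is, the field of p-adic numbers (determined up to a unique isometric
   isomorphism). *)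
Definition is_padic_field (R : realType) (p : nat) (K : fieldType) (v : K -> R) : Prop :=
  [/\ ultrametric_abs v,
      forall x : rat, v (ratr x) = padic_abs R p x,
      forall (x : K) (eps : R), 0 < eps -> exists r : rat, v (x - ratr r) < eps &
      forall u : nat -> K, cauchy_for v u -> exists l : K, converges_for v u l].

(* For [h 0 = 0], [h ^ k] has order at least [k], so the coefficient of [T^n]
   in [exp h] only involves the truncation of [h] at degree [n] and the terms
   [h ^ k / k!] with [k <= n]. *)
Definition fps_exp (K : fieldType) (h : nat -> K) (n : nat) : K :=
  (\sum_(k < n.+1) (k`!%:R)^-1 *: (\poly_(i < n.+1) h i) ^+ k)`_n.

Definition reciprocal_root (K : fieldType) (h : nat -> K) (eta : K) : Prop :=
  exists s : seq K,
    [/\ 0 \notin s,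
        forall i, h i = (\prod_(a <- s) (1 - a *: 'X))`_i &
        eta \in s].

Definition additive_character (F : finFieldType) (K : fieldType) (psi : F -> K) : Prop :=
  psi 0 = 1 /\ {morph psi : x y / x + y >-> x * y}.

Section Sums.

Variables (F : finFieldType) (E : fieldExtType F).

(* [finvect_type E] is [E] with its canonical finite and splitting field
   structures. *)
Local Notation fE := (finvect_type E).

(* [galTrace] takes its values in the ambient field [fE], in the line [F * 1];
   [trace x] is the corresponding element of [F]. *)
Definition trace (x : fE) : F :=
  odflt 0 [pick c : F | c%:A == galTrace 1%AS {:fE} x].

Definition exp_sum (K : fieldType) (psi : F -> K) (f g : {poly F}) : K :=
  \sum_(x : fE | (map_poly (in_alg fE) g).[x] != 0)
     psi (trace ((map_poly (in_alg fE) f).[x] / (map_poly (in_alg fE) g).[x])).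

End Sums.

(* [E m] plays the role of the extension of degree [m] of [F]; [E 0] is not
   used. *)
Definition Lfun (F : finFieldType) (E : nat -> fieldExtType F) (K : fieldType)
    (psi : F -> K) (f g : {poly F}) : nat -> K :=
  fps_exp (fun m => if m == 0%N then 0 else exp_sum (E m) psi f g / m%:R).

Definition num_roots (C : closedFieldType) (h : {poly C}) : nat :=
  size (undup (sval (closed_field_poly_normal h))).

Definition pole_order (C : fieldType) (f g : {poly C}) (a : C) : nat :=
  (mup a g - mup a f)%N.

(* Equal to [deg f - deg g] for nonzero [f] and [g]. *)
Definition pole_order_infty (C : fieldType) (f g : {poly C}) : nat :=
  (size f - size g)%N.

(* Main.v *)
Require Import Defs.
From HB Require Import structures.
From mathcomp Require Import all_boot all_order all_algebra all_fingroup all_field.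
From mathcomp Require Import reals.
From mathcomp Require Import cyclic ring.

Set Implicit Arguments.
Unset Strict Implicit.
Unset Printing Implicit Defensive.

Import Order.TTheory GRing.Theory Num.Theory.

Local Open Scope ring_scope.

(** Let c_O be the value of [psi] at the trace of f / g along an orbit O of the
    q-Frobenius on the points of the affine line where g does not vanish. The
    Euler product of L(f/g, T) over these orbits has the factors
    1 / (1 - c_O T^|O|), and c_O, being a p-th root of unity, is congruent to 1
    modulo the maximal ideal. Hence L(f/g, T) is integral and congruent to the
    zeta function (1 - T)^n / (1 - q T) of the affine line minus n points.
    Evaluating at 1/eta gives |1 - 1/eta|^n < 1.

    Power series identities are proved modulo T^(N+1), by comparing logarithmic
    derivatives; the coefficients up to T^N only see the extensions of degree
    at most N, which all embed into the extension of degree N!. *)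

(** * Embeddings of finite fields, and exponential sums carried into one large extension *)

Section FiniteFieldExtensions.

Variable F : finFieldType.

Lemma expr_iter_fixed (E : pzRingType) (x : E) (n k : nat) :
  x ^+ n = x -> x ^+ (n ^ k) = x.
Proof. by move=> xn; elim: k => [|k IH]; rewrite ?expn0 ?expr1 // expnSr exprM IH. Qed.

Lemma card_finvect (L : fieldExtType F) :
  #|finvect_type L| = (#|F| ^ \dim {:L})%N.
Proof.
rewrite -(@card_vspacef F _ (Vector.class (finvect_type L))).
exact: (@card_vspace F (finvect_type L)).
Qed.

Lemma fieldExt_primitive_element (K : fieldExtType F) :
  exists z : K, forall x : K, exists r : {poly F}, x = (map_poly (in_alg K) r).[z].
Proof.
have sep : separable 1%AS {: finvect_type K}.
  by have /and3P[] := finField_galois (sub1v {: finvect_type K}%AS).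
exists (separable_generator 1%AS {: finvect_type K}) => x.
apply/(@Fadjoin1_polyP F (finvect_type K)).
by rewrite -(eq_adjoin_separable_generator sep (sub1v _)) memvf.
Qed.

(** Let [z] generate [K]. Since [#|W|] is a power of [#|K|], [z] is a root of X^#|W| - X, which
    splits over [W]; hence so does the minimal polynomial [P] of [z], and [z] can be sent to a root
    [r] of [P] in [W]. *)
Lemma finfield_embedding (K W : fieldExtType F) :
  (\dim {:K} %| \dim {:W})%N ->
  exists theta : {rmorphism K -> W}, forall a : F, theta a%:A = a%:A.
Proof.
move=> /dvdnP[k dimW]; have [z genz] := fieldExt_primitive_element K.
have /polyOver1P[P DP] := minPolyOver 1 z.
have dvdP (u : {poly F}) : root (map_poly (in_alg K) u) z -> P %| u.
  move=> uz; rewrite -(dvdp_map (in_alg K)) -DP minPoly_dvdp //.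
  exact: alg_polyOver.
have PdvdW : map_poly (in_alg W) P %| \prod_(w : finvect_type W) ('X - w%:P).
  rewrite -(finField_genPoly (finvect_type W)).
  have -> : 'X^#|finvect_type W| - 'X =
      map_poly (in_alg W) ('X^#|finvect_type W| - 'X).
    by rewrite rmorphB /= map_polyXn map_polyX.
  rewrite dvdp_map; apply: dvdP; rewrite rmorphB /= map_polyXn map_polyX.
  rewrite rootE !hornerE subr_eq0; apply/eqP.
  rewrite card_finvect dimW mulnC expnM -card_finvect.
  by apply: (@expr_iter_fixed (finvect_type K)); rewrite expf_card.
have [r rootr] : exists r : W, root (map_poly (in_alg W) P) r.
  move: PdvdW; rewrite -big_enum => /dvdp_prod_XsubC[m eqP].
  have := size_minPoly 1 z; rewrite DP size_map_poly => szP.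
  move: (eqp_size eqP); rewrite size_prod_XsubC size_map_poly szP => -[].
  case: (mask m _) eqP => [//|r s] eqP _; exists r.
  by rewrite (eqp_root eqP) root_prod_XsubC inE eqxx.
pose lift x := sval (sig_eqW (genz x)).
have liftE x : x = (map_poly (in_alg K) (lift x)).[z] 
  := svalP (sig_eqW (genz x)).
pose theta x := (map_poly (in_alg W) (lift x)).[r].
(* The value does not depend on the chosen representative: two polynomials that agree at [z] differ
   by a multiple of [P], which vanishes at [r]. Additivity and multiplicativity follow. *)
have thetaE x u : x = (map_poly (in_alg K) u).[z] ->
    theta x = (map_poly (in_alg W) u).[r].
  move=> xu; apply/eqP; rewrite -subr_eq0 -hornerN -hornerD -rmorphB /=.
  have /dvdpP[w ->] : P %| lift x - u.
    by apply: dvdP; rewrite rmorphB rootE !hornerE /= -liftE -xu subrr.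
  by rewrite rmorphM hornerM (rootP rootr) mulr0.
have thetaB : zmod_morphism theta.
  move=> x y; rewrite (thetaE _ (lift x - lift y)) rmorphB !hornerE //=.
  by rewrite -!liftE.
have thetaM : monoid_morphism theta.
  split=> [|x y]; first by rewrite (thetaE _ 1) rmorph1 hornerE.
  rewrite (thetaE _ (lift x * lift y)) rmorphM !hornerE //=.
  by rewrite -!liftE.
pose thB := GRing.isZmodMorphism.Build _ _ theta thetaB.
pose thM := GRing.isMonoidMorphism.Build _ _ theta thetaM.
exists (HB.pack theta thB thM : {rmorphism K -> W}) => a.
by rewrite /= (thetaE _ a%:P) map_polyC hornerC.
Qed.

(** The Galois group is cyclic, generated by the [#|F|]-power map, and its order is the degree. *)
Lemma galTrace_Frobenius (E : fieldExtType F) (x : finvect_type E) :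
  galTrace 1%AS {: finvect_type E} x = \sum_(i < \dim {:E}) x ^+ (#|F| ^ i).
Proof.
set L := finvect_type E.
have [alpha /eqP genG alphaE] := finField_galois_generator (sub1v {:L}%AS).
have ordA : #[alpha]%g = \dim {:E}.
  rewrite orderE -genG -galois_dim; last exact: finField_galois (sub1v _).
  by rewrite dimv1 divn1.
have powE i : (alpha ^+ i)%g x = x ^+ (#|F| ^ i).
  elim: i => [|i IH]; first by rewrite expg0 gal_id expn0 expr1.
  by rewrite expgSr galM ?memvf // IH alphaE ?memvf // dimv1 expn1 expnSr exprM.
rewrite /galTrace genG -ordA.
rewrite (eq_bigl [in [set (alpha ^+ i)%g | i : 'I_#[alpha]%g]]); last first.
  move=> s; apply/idP/imsetP => [/cyclePmin[i lti ->]|[i _ ->]].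
    by exists (Ordinal lti).
  exact: mem_cycle.
rewrite big_imset /= => [|i k _ _ /eqP]; last first.
  by rewrite eq_expg_mod_order !modn_small ?ltn_ord // => /eqP/val_inj.
by apply: eq_big => i; rewrite ?inE // powE.
Qed.

(* The trace of [y] to [F], if [y] is fixed by the [m]-th power of Frobenius. *)
Definition Frobenius_trace (E : fieldExtType F) (m : nat) (y : E) : F :=
  odflt 0 [pick c : F | c%:A == \sum_(i < m) y ^+ (#|F| ^ i)].

(** The image of [theta] consists of roots of X^q - X with q = [#|K|]; it has q elements and the
    polynomial has at most q roots, so the two sets coincide. *)
Lemma sum_embedding (V : zmodType) (K W : fieldExtType F)
    (G : finvect_type W -> V) (theta : {rmorphism K -> W}) :
  \sum_(x : finvect_type K) G (theta x) =
  \sum_(y : finvect_type W | y ^+ #|finvect_type K| == y) G y.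
Proof.
set q := #|_|; pose th : finvect_type K -> finvect_type W := theta.
have thI : injective th by exact: fmorph_inj.
have fixE : th @: [set: finvect_type K] = [set y | y ^+ q == y].
  apply/eqP; rewrite eqEcard; apply/andP; split.
    apply/subsetP=> _ /imsetP[x _ ->]; rewrite inE -[_ ^+ q](rmorphXn theta).
    by rewrite [X in theta X](@expf_card (finvect_type K)).
  rewrite card_imset // -/q cardsT cardE.
  have szq : size ('X^q - 'X : {poly finvect_type W}) = q.+1.
    by rewrite size_polyDl size_polyXn // size_polyN size_polyX ltnS finNzRing_gt1.
  rewrite -ltnS -szq; apply: max_poly_roots; rewrite ?enum_uniq //.
    by rewrite -size_poly_eq0 szq.
  apply/allP=> y; rewrite mem_enum inE => /eqP yq.
  by rewrite rootE !hornerE yq subrr.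
have -> : \sum_(x : finvect_type K) G (theta x) =
    \sum_(x in [set: finvect_type K]) G (th x).
  by apply: eq_bigl => x; rewrite inE.
rewrite -(big_imset G) /= => [|x y _ _]; last exact: thI.
by rewrite fixE; apply: eq_bigl => y; rewrite inE.
Qed.

(** With sums of different degrees written over the same [W], their terms can be grouped along the
    same Frobenius orbits. *)
Lemma exp_sum_embedding (C : fieldType) (psi : F -> C) (f g : {poly F})
    (K W : fieldExtType F) :
  (\dim {:K} %| \dim {:W})%N ->
  exp_sum K psi f g =
  \sum_(y : finvect_type W | (y ^+ (#|F| ^ \dim {:K}) == y)
                             && ((map_poly (in_alg W) g).[y] != 0))
     psi (Frobenius_trace (\dim {:K})
       ((map_poly (in_alg W) f).[y] / (map_poly (in_alg W) g).[y])).
Proof.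
move=> /finfield_embedding[theta thetaA]; rewrite -card_finvect.
rewrite big_mkcondr -(sum_embedding _ theta) -big_mkcond.
have hornerE u x :
    (map_poly (in_alg W) u).[theta x] = theta (map_poly (in_alg K) u).[x].
  rewrite -horner_map -map_poly_comp; congr (_.[_]).
  by apply: eq_map_poly => a; rewrite /= thetaA.
apply: eq_big => x; rewrite hornerE ?fmorph_eq0 // => _.
rewrite hornerE -fmorph_div; congr psi; rewrite /trace /Frobenius_trace.
congr odflt; apply: eq_pick => c /=.
rewrite galTrace_Frobenius -(inj_eq (fmorph_inj theta)) thetaA rmorph_sum.
by congr (_ == _); apply: eq_bigr => i _; rewrite rmorphXn.
Qed.

End FiniteFieldExtensions.

(** * Truncated power series and their logarithmic derivatives *)

Section LogarithmicDerivative.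

Variable K : fieldType.
Implicit Types (L M : {poly K}) (S : nat -> K).

Lemma dvdp_XnP (N : nat) (L : {poly K}) :
  reflect (forall i, (i < N)%N -> L`_i = 0) ('X^N %| L).
Proof.
apply: (iffP (dvdpP _ _)) => [[M ->] i ltiN | L0].
  by rewrite coefMXn ltiN.
exists (drop_poly N L); rewrite -[LHS](poly_take_drop N L) addrC.
have -> : take_poly N L = 0; last by rewrite addr0.
by apply/polyP=> i; rewrite coef_take_poly coef0; case: ifP => // /L0.
Qed.

(* [X L' / L] and [\sum_(m >= 1) S m X^m] agree modulo [X^(N + 1)]. *)
Definition log_deriv (N : nat) S L : Prop :=
  L`_0 = 1 /\ 'X^N %| L^`() - (\poly_(i < N) S i.+1) * L.

Lemma eq_log_deriv (N : nat) S1 S2 L :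
  (forall m, (0 < m <= N)%N -> S1 m = S2 m) ->
  log_deriv N S1 L -> log_deriv N S2 L.
Proof.
move=> eqS [L0 LN]; split=> //.
suff <- : \poly_(i < N) S1 i.+1 = \poly_(i < N) S2 i.+1 by [].
by apply/polyP=> i; rewrite !coef_poly; case: ifP => // ltiN; rewrite eqS.
Qed.

Lemma log_deriv1 (N : nat) : log_deriv N (fun _ => 0) 1.
Proof.
split; first by rewrite coef1.
suff -> : \poly_(i < N) (0 : K) = 0 by rewrite mul0r subr0 derivC dvdp0.
by apply/polyP=> i; rewrite coef_poly coef0 if_same.
Qed.

Lemma log_derivM (N : nat) S1 S2 L1 L2 :
  log_deriv N S1 L1 -> log_deriv N S2 L2 ->
  log_deriv N (fun m => S1 m + S2 m) (L1 * L2).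
Proof.
move=> [L10 D1] [L20 D2]; split; first by rewrite coef0M L10 L20 mulr1.
have -> : \poly_(i < N) (S1 i.+1 + S2 i.+1) =
    \poly_(i < N) S1 i.+1 + \poly_(i < N) S2 i.+1.
  by apply/polyP=> i; rewrite coefD !coef_poly; case: ifP => // _; rewrite addr0.
have := dvdp_add (dvdp_mulr L2 D1) (dvdp_mull L1 D2).
rewrite derivM; congr (_ %| _); ring.
Qed.

Lemma log_deriv_prod (N : nat) (I : Type) (r : seq I) (P : pred I)
    (S : I -> nat -> K) (L : I -> {poly K}) :
  (forall i, P i -> log_deriv N (S i) (L i)) ->
  log_deriv N (fun m => \sum_(i <- r | P i) S i m) (\prod_(i <- r | P i) L i).
Proof.
move=> LS; elim: r => [|i r IH].
  rewrite big_nil; apply: eq_log_deriv (log_deriv1 N) => m _.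
  by rewrite big_nil.
rewrite big_cons; case: ifP => Pi; last first.
  by apply: eq_log_deriv IH => m _; rewrite big_cons Pi.
by apply: eq_log_deriv (log_derivM (LS i Pi) IH) => m _; rewrite big_cons Pi.
Qed.

(** This is the geometric expansion of - d c X^d / (1 - c X^d). After multiplication by 1 - c X^d,
    the coefficients cancel in pairs at distance [d]. *)
Lemma log_deriv_1subXn (N d : nat) (c : K) :
  (0 < d)%N ->
  log_deriv N (fun m => - (if (d %| m)%N then c ^+ (m %/ d) *+ d else 0))
    (1 - c *: 'X^d).
Proof.
move=> d_gt0; split.
  by rewrite coefB coef1 coefZ coefXn (ltn_eqF d_gt0) mulr0 subr0.
apply/dvdp_XnP=> i ltiN.
rewrite mulrBr mulr1 -scalerAr coefB coef_deriv !coefB coef1 !coefZ coefXn.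
rewrite coefMXn !coef_poly ltiN sub0r.
have [ltid|ledi] := ltnP i d.
  rewrite mulr0 subr0; have [->|neq] := eqVneq i.+1 d.
    by rewrite dvdnn divnn d_gt0 expr1 mulr1 mulNrn opprK addNr.
  rewrite mulr0 oppr0 mul0rn sub0r opprK.
  case: ifP => // /dvdn_leq -/(_ isT); rewrite leq_eqVlt => /orP[/eqP/esym/eqP|].
    by rewrite (negPf neq).
  by rewrite ltnNge ltid.
rewrite (leq_ltn_trans (leq_subr d i) ltiN) gtn_eqF // mulr0 oppr0 mul0rn sub0r.
rewrite -subSn // dvdn_subl ?dvdnn //; last exact: leqW.
case: ifP => [/dvdnP[k eqk]|_]; last by rewrite oppr0 mulr0 subr0 oppr0.
rewrite eqk; case: k eqk => [//|k] eqk.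
by rewrite mulSn addKn -mulSn !mulnK // mulrN mulrnAr -exprS subrr oppr0.
Qed.

Hypothesis char0 : forall k : nat, k.+1%:R != 0 :> K.

(** The difference D satisfies the same linear equation with D(0) = 0. The coefficient of degree i
    in the equation expresses (i + 1) D_(i+1) through earlier coefficients; this is why a relation
    modulo X^N gives equality modulo X^(N+1). *)
Lemma log_deriv_uniq (N : nat) S L M :
  log_deriv N S L -> log_deriv N S M -> 'X^(N.+1) %| L - M.
Proof.
move=> [L0 DL] [M0 DM]; apply/dvdp_XnP; set D := L - M.
have : 'X^N %| D^`() - (\poly_(i < N) S i.+1) * D.
  have := dvdp_sub DL DM; rewrite /D derivB; congr (_ %| _); ring.
move=> /dvdp_XnP DN i; have [k] := ubnP i.
elim: k i => [//|k IH] [|i] leik ltiN; first by rewrite coefB L0 M0 subrr.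
have /eqP := DN i ltiN; rewrite coefB coef_deriv coefM big1 => [|j _].
  by rewrite subr0 -mulr_natr mulf_eq0 (negPf (char0 i)) orbF => /eqP.
have leij : (i - j <= i)%N := leq_subr _ _.
by rewrite IH ?mulr0 ?(leq_ltn_trans leij) // ltnW.
Qed.

Lemma log_deriv_fps_exp (N : nat) S L :
  (forall i, L`_i = fps_exp (fun m => if m == 0%N then 0 else S m / m%:R) i) ->
  log_deriv N S L.
Proof.
set h := fun m => _; move=> LE.
pose H n := \poly_(i < n.+1) h i.
have XdvdH n : 'X %| H n.
  by rewrite -['X]expr1; apply/dvdp_XnP=> -[|//] _; rewrite coef_poly.
have XndvdH n k : 'X^k %| H n ^+ k by rewrite dvdp_exp2r.
pose e := \sum_(k < N.+1) (k`!%:R)^-1 *: H N ^+ k.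
(* [fps_exp] truncates at a level that varies with [i]. The level [N] may replace it: [H n ^+ k] has
   order at least [k], so the extra terms do not reach degree [i]. *)
have Le i : (i < N.+1)%N -> L`_i = e`_i.
  rewrite ltnS => leiN; rewrite LE /fps_exp /e !coef_sum.
  rewrite -!(big_mkord xpredT (fun k => ((k`!%:R)^-1 *: H _ ^+ k)`_i)).
  rewrite [RHS](big_cat_nat (n := i.+1)) //= [X in _ = _ + X]big_nat_cond.
  rewrite [X in _ = _ + X]big1 ?addr0.
    apply: eq_bigr => k _; rewrite !coefZ; congr (_ * _).
    apply/eqP; rewrite -subr_eq0 -coefB.
    suff /dvdp_XnP-> : 'X^(i.+1) %| H i ^+ k - H N ^+ k by [].
    rewrite subrXX dvdp_mulr //; apply/dvdp_XnP=> l ltli.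
    by rewrite coefB !coef_poly ltli ltnS (leq_trans _ leiN) ?subrr.
  move=> k; rewrite andbT => /andP[ltik _].
  by rewrite coefZ (dvdp_XnP _ _ (XndvdH N k)) ?mulr0.
have fact0 k : (k`!%:R : K) != 0 by rewrite -(prednK (fact_gt0 k)).
have dH : (H N)^`() = \poly_(i < N) S i.+1.
  apply/polyP=> i; rewrite coef_deriv !coef_poly ltnS; case: ifP => // _.
    by rewrite /h /= -[LHS]mulr_natr divfK.
  by rewrite mul0rn.
(* Differentiation shifts the exponential series by one term; the term lost at the end is divisible
   by X^N. *)
have de : e^`() = (H N)^`() * (e - (N`!%:R)^-1 *: H N ^+ N).
  rewrite /e [in RHS]big_ord_recr addrK /= raddf_sum big_ord_recl /=.
  rewrite expr0 alg_polyC derivC add0r mulr_sumr; apply: eq_bigr => i _.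
  rewrite derivZ deriv_exp /bump /= add1n -scaler_nat scalerA -[RHS]scalerAr.
  congr (_ *: _); rewrite factS natrM invfM mulrAC mulVf ?mul1r ?char0 //.
split.
  rewrite Le // coef_sum big_ord_recl coefZ expr0 coef1 /= invr1 mulr1.
  by rewrite big1 ?addr0 // => i _; rewrite coefZ (dvdp_XnP _ _ (XndvdH N _)) ?mulr0.
have -> : L^`() - (\poly_(i < N) S i.+1) * L =
    (L - e)^`() - (H N)^`() * (L - e) - (H N)^`() * ((N`!%:R)^-1 *: H N ^+ N).
  rewrite derivB de -dH; ring.
apply: dvdp_sub; last by rewrite dvdp_mull // dvdpZr ?invr_eq0 ?fact0.
have Le0 i : (i < N.+1)%N -> (L - e)`_i = 0.
  by move=> ltiN; rewrite coefB Le ?subrr.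
apply: dvdp_sub; last first.
  by apply: dvdp_mull; apply/dvdp_XnP=> i ltiN; rewrite Le0 // ltnW.
by apply/dvdp_XnP=> i ltiN; rewrite coef_deriv Le0 ?mul0rn.
Qed.

End LogarithmicDerivative.

(** * Euler products over the orbits of a permutation of a finite set *)

Section OrbitProduct.

Variables (T : finType) (phi : T -> T).
Hypothesis phi_inj : injective phi.

(** [findex] recovers any iteration count below the orbit length, so the remainder of [m] modulo
    that length fixes [x] only if it is 0. *)
Lemma iter_fixed_order (m : nat) (x : T) :
  (iter m phi x == x) = (fingraph.order phi x %| m)%N.
Proof.
set d := fingraph.order phi x.
have iter_mul k : iter (k * d) phi x = x.
  by elim: k => [//|k IH]; rewrite mulSn iterD IH iter_order.
rewrite {1}(divn_eq m d) addnC iterD iter_mul /dvdn.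
apply/eqP/eqP => [fix_r|->] //.
have ltr : (m %% d < d)%N by rewrite ltn_mod fingraph.order_gt0.
by have := findex_iter ltr; rewrite fix_r findex0.
Qed.

Variables (K : fieldType) (A : pred T) (c : T -> K).
Hypotheses (A_phi : forall x, A (phi x) = A x) (c_phi : forall x, c (phi x) = c x).

(** Orbits are represented by their [froot]. An orbit of length d lies in the fixed set of the m-th
    iterate exactly when d divides [m], and then it contributes d equal terms. *)
Lemma sum_fixed_points (m : nat) :
  \sum_(x | (iter m phi x == x) && A x) c x ^+ (m %/ fingraph.order phi x) =
  \sum_(r | froots phi r && A r)
     (if (fingraph.order phi r %| m)%N
      then c r ^+ (m %/ fingraph.order phi r) *+ fingraph.order phi r else 0).
Proof.
have invar (S : eqType) (k : T -> S) :
    (forall x, k (phi x) = k x) -> forall x y, fconnect phi x y -> k x = k y.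
  by move=> kphi x y /fconnect_invariant-> // z; apply/eqP.
have ord_phi x : fingraph.order phi (phi x) = fingraph.order phi x.
  by apply/eq_card => y; rewrite -!topredE /= -same_fconnect1.
have rootE x : fconnect phi x (froot phi x) := connect_root _ x.
rewrite (partition_big (froot phi) (fun r => froots phi r && A r)) =>
  [|x /andP[_ Ax]]; last first.
  by rewrite roots_root ?(invar _ _ A_phi _ _ (rootE x)) // in Ax *; exact: fconnect_sym.
apply: eq_bigr => r /andP[/eqP rr Ar].
have conE x : (froot phi x == r) = fconnect phi r x.
  by rewrite -{1}rr (root_connect (fconnect_sym phi_inj)) fconnect_sym.
case: ifP => dvd_m; last first.
  rewrite big1 // => x /andP[/andP[]]; rewrite iter_fixed_order conE => dvd _ rx.
  by rewrite (invar _ _ ord_phi _ _ rx) dvd in dvd_m.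
rewrite -[in RHS](sumr_const (fconnect phi r)); apply: eq_big => [x|x].
  rewrite conE iter_fixed_order; apply: andb_idl => rx.
  by rewrite -(invar _ _ ord_phi _ _ rx) dvd_m -(invar _ _ A_phi _ _ rx).
rewrite conE => /andP[_ rx].
by rewrite (invar _ _ ord_phi _ _ rx) (invar _ _ c_phi _ _ rx).
Qed.

(** The inverse of the Euler product, which makes it a polynomial. *)
Definition orbit_prod : {poly K} :=
  \prod_(r | froots phi r && A r) (1 - c r *: 'X^(fingraph.order phi r)).

Lemma log_deriv_orbit_prod (N : nat) :
  log_deriv N
    (fun m => - \sum_(x | (iter m phi x == x) && A x)
                  c x ^+ (m %/ fingraph.order phi x))
    orbit_prod.
Proof.
have := @log_deriv_prod K N T (index_enum T) (fun r => froots phi r && A r) _ _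
  (fun r _ => log_deriv_1subXn N (c r) (fingraph.order_gt0 phi r)).
by apply: eq_log_deriv => m _; rewrite sum_fixed_points sumrN.
Qed.

End OrbitProduct.

(** * Ultrametric estimates, and congruences modulo the maximal ideal *)

Section Ultrametric.

Variables (R : realType) (K : fieldType) (v : K -> R).
Hypothesis v_abs : ultrametric_abs v.

Let v_ge0 x : 0 <= v x. Proof. by case: v_abs. Qed.
Let v_eq0 x : v x = 0 <-> x = 0. Proof. by case: v_abs. Qed.
Let vM x y : v (x * y) = v x * v y. Proof. by case: v_abs. Qed.

Lemma ultrametric0 : v 0 = 0. Proof. exact/v_eq0. Qed.

Lemma ultrametric1 : v 1 = 1.
Proof.
have v1_neq0 : v 1 != 0 by apply/eqP => /v_eq0/eqP; rewrite oner_eq0.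
by apply: (mulfI v1_neq0); rewrite -vM !mulr1.
Qed.

Lemma ultrametricN x : v (- x) = v x.
Proof.
have vN1 : v (-1) = 1.
  by apply/eqP; rewrite -(@pexpr_eq1 _ _ 2) // expr2 -vM mulrNN mulr1 ultrametric1.
by rewrite -mulN1r vM vN1 mul1r.
Qed.

Lemma ultrametricX x n : v (x ^+ n) = v x ^+ n.
Proof. by elim: n => [|n IH]; rewrite ?expr0 ?ultrametric1 // !exprS vM IH. Qed.

Lemma ultrametric_sum_le (I : Type) (r : seq I) (P : pred I) (G : I -> K) (B : R) :
  0 <= B -> (forall i, P i -> v (G i) <= B) -> v (\sum_(i <- r | P i) G i) <= B.
Proof.
move=> B0 GB; elim/big_ind: _ => [|x y xB yB|//]; first by rewrite ultrametric0.
by case: v_abs => _ _ _ /(_ x y)/le_trans; apply; rewrite ge_max xB.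
Qed.

Lemma ultrametric_sum_lt (I : Type) (r : seq I) (P : pred I) (G : I -> K) (B : R) :
  0 < B -> (forall i, P i -> v (G i) < B) -> v (\sum_(i <- r | P i) G i) < B.
Proof.
move=> B0 GB; elim/big_ind: _ => [|x y xB yB|//]; first by rewrite ultrametric0.
by case: v_abs => _ _ _ /(_ x y)/le_lt_trans; apply; rewrite gt_max xB.
Qed.

Lemma ultrametricD_le x y B : v x <= B -> v y <= B -> v (x + y) <= B.
Proof.
by move=> xB yB; case: v_abs => _ _ _ /(_ x y)/le_trans; apply; rewrite ge_max xB.
Qed.

Lemma ultrametricD_lt x y B : v x < B -> v y < B -> v (x + y) < B.
Proof.
by move=> xB yB; case: v_abs => _ _ _ /(_ x y)/le_lt_trans; apply; rewrite gt_max xB.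
Qed.

Lemma ultrametric_nat_le1 n : v n%:R <= 1.
Proof.
elim: n => [|n IH]; first by rewrite ultrametric0.
by rewrite -natr1 ultrametricD_le ?ultrametric1.
Qed.

(** Put c = 1 + t and expand c^p = 1: t^p is minus a sum of integral terms whose binomial
    coefficients are divisible by [p], so |t|^p < 1. *)
Lemma root_unity_one_unit (p : nat) (c : K) :
  prime p -> v p%:R < 1 -> c ^+ p = 1 -> v (c - 1) < 1.
Proof.
move=> p_pr vp cp; have p_gt0 := prime_gt0 p_pr.
have vc : v c = 1.
  by apply/eqP; rewrite -(@pexpr_eq1 _ _ p) // -ultrametricX cp ultrametric1.
set t := c - 1; have vt : v t <= 1.
  by rewrite ultrametricD_le ?ultrametricN ?vc ?ultrametric1.
rewrite -(@expr_lt1 _ p) // -ultrametricX.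
case: p p_pr vp cp p_gt0 => // k p_pr vp cp _.
have tp : t ^+ k.+1 = - \sum_(i < k) t ^+ i.+1 *+ 'C(k.+1, i.+1).
  move: cp; rewrite -[c](subrK 1) -/t exprD1n big_ord_recl big_ord_recr /=.
  rewrite bin0 binn expr0 !mulr1n => /(canRL (addKr _)).
  by rewrite addNr addrC => /eqP; rewrite addr_eq0 => /eqP.
rewrite tp ultrametricN; apply: ultrametric_sum_lt => // i _.
have /dvdnP[m ->] : (k.+1 %| 'C(k.+1, i.+1))%N.
  by rewrite prime_dvd_bin //= ltnS ltn_ord.
rewrite -mulr_natl natrM mulrAC vM; apply: le_lt_trans vp.
rewrite ler_piMl // vM ultrametricX.
by rewrite mulr_ile1 ?ultrametric_nat_le1 ?exprn_ge0 ?exprn_ile1.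
Qed.

Definition integral_poly (P : {poly K}) := forall i, v P`_i <= 1.
Definition small_poly (P : {poly K}) := forall i, v P`_i < 1.

Lemma integral_polyM P Q : integral_poly P -> integral_poly Q -> integral_poly (P * Q).
Proof.
move=> iP iQ i; rewrite coefM; apply: ultrametric_sum_le => // j _.
by rewrite vM mulr_ile1.
Qed.

Lemma small_polyM P Q : integral_poly P -> small_poly Q -> small_poly (P * Q).
Proof.
move=> iP sQ i; rewrite coefM; apply: ultrametric_sum_lt => // j _.
by rewrite vM; apply: le_lt_trans (sQ (i - j)%N); rewrite ler_piMl ?iP.
Qed.

Lemma integral_poly1 : integral_poly 1.
Proof. by move=> i; rewrite coef1 ultrametric_nat_le1. Qed.

(** Congruences modulo the maximal ideal can be multiplied, provided that the factors are
    integral. *)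
Lemma small_poly_prodB (I : Type) (r : seq I) (P : pred I) (G H : I -> {poly K}) :
  (forall i, P i ->
    [/\ integral_poly (G i), integral_poly (H i) & small_poly (G i - H i)]) ->
  [/\ integral_poly (\prod_(i <- r | P i) G i),
      integral_poly (\prod_(i <- r | P i) H i) &
      small_poly (\prod_(i <- r | P i) G i - \prod_(i <- r | P i) H i)].
Proof.
move=> GH; elim/big_ind2: _ => [|h1 g1 h2 g2 [ig1 ih1 s1] [ig2 ih2 s2]|//].
  split; [exact: integral_poly1|exact: integral_poly1|].
  by move=> i; rewrite subrr coef0 ultrametric0.
split; [exact: (integral_polyM ig1 ig2)|exact: (integral_polyM ih1 ih2)|].
have -> : g1 * g2 - h1 * h2 = g1 * (g2 - h2) + h2 * (g1 - h1) by ring.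
by move=> i; rewrite coefD ultrametricD_lt ?small_polyM.
Qed.

Lemma integral_1subXn (c : K) (d : nat) :
  v c <= 1 -> integral_poly (1 - c *: 'X^d).
Proof.
move=> vc i; rewrite coefB coefZ coefXn ultrametricD_le ?ultrametricN ?integral_poly1 //.
by rewrite vM mulr_ile1 // ultrametric_nat_le1.
Qed.

(** In the application the product over [s] is the L-function, [D] its inverse modulo X^(N+1), and
    [D1] the inverse of the zeta function of the punctured line. *)
Lemma reciprocal_root_one_unit (s : seq K) (D D1 : {poly K}) (q n N : nat) :
  integral_poly D -> small_poly (D - D1) -> D`_0 = 1 ->
  (size s < N)%N -> (n <= N)%N ->
  'X^(N.+1) %| \prod_(a <- s) (1 - a *: 'X) * D - 1 ->
  'X^(N.+1) %| D1 * (1 - 'X) ^+ n - (1 - q%:R *: 'X) ->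
  forall eta, eta \in s -> v eta = 1 -> v (eta - 1) < 1.
Proof.
set P := \prod_(a <- s) _; set A := (1 - 'X) ^+ n; set Z := 1 - q%:R *: 'X.
move=> iD sDD1 D0 szN nN /dvdp_XnP PD1 D1AZ eta etas veta.
have szlin (a : K) : (size (1 - a *: 'X)%R <= 2)%N.
  rewrite (leq_trans (size_polyD _ _)) // geq_max size_poly1 size_polyN.
  by rewrite (leq_trans (size_scale_leq _ _)) ?size_polyX.
have szP : (size P <= (size s).+1)%N.
  rewrite /P; elim: (s) => [|a r IH]; first by rewrite big_nil size_poly1.
  rewrite big_cons (leq_trans (size_polyMleq _ _)) // -subn1 leq_subLR.
  exact: leq_trans (leq_add (szlin a) IH) _.
have szA : (size A <= n.+1)%N.
  have := size_poly_exp_leq (1 - 'X : {poly K}) n.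
  move/leq_trans; apply; rewrite ltnS -[X in (_ <= X)%N]mul1n leq_mul2r.
  by rewrite -subn1 leq_subLR -['X]scale1r szlin orbT.
(* Up to degree [N], P D = 1 with D(0) = 1 gives each coefficient of [P] as an integral expression
   in the previous ones; beyond [N], [P] has no coefficients. *)
have iP : integral_poly P.
  move=> i; have [ltNi|] := ltnP N i.
    by rewrite nth_default ?ultrametric0 // (leq_trans szP) // (leq_trans szN) // ltnW.
  have [k] := ubnP i; elim: k i => // k IH i leik leiN.
  have := PD1 i leiN; rewrite coefB coefM big_ord_recr /= subnn D0 mulr1.
  move=> /eqP; rewrite subr_eq0 addrC => /eqP/(canRL (addrK _)) ->.
  rewrite ultrametricD_le ?integral_poly1 // ultrametricN.
  apply: ultrametric_sum_le => // j _; rewrite vM mulr_ile1 //.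
  by rewrite IH ?(leq_trans (ltn_ord j)) // ltnW // (leq_trans (ltn_ord j)).
have iA : integral_poly A.
  rewrite /A; elim: (n) => [|k IH]; first by rewrite expr0; exact: integral_poly1.
  rewrite exprS; apply: integral_polyM IH; rewrite -['X]scale1r.
  by apply: (@integral_1subXn 1 1); rewrite ultrametric1.
(* The congruence of [P] with A / Z, cleared of its denominator. Both P Z and [A] have degree at
   most [N], so nothing is lost by working modulo X^(N+1). *)
set B := P * Z - A.
have sB : small_poly B.
  move=> i; have [ltNi|leiN] := ltnP N i.
    rewrite nth_default ?ultrametric0 //; apply: leq_trans ltNi.
    rewrite (leq_trans (size_polyD _ _)) // size_polyN geq_max.
    rewrite (leq_trans szA) ?ltnS // andbT (leq_trans (size_polyMleq _ _)) //.
    rewrite -subn1 leq_subLR (leq_trans (leq_add szP (szlin q%:R))) //.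
    by rewrite addn2 add1n !ltnS.
  (* This combines the two hypotheses: A (P D - 1) - P (D1 A - Z) = B - P A (D1 - D). *)
  have -> : B`_i = (P * A * (D1 - D))`_i.
    apply/eqP; rewrite -subr_eq0 -coefB.
    have /dvdp_XnP-> // : 'X^(N.+1) %| B - P * A * (D1 - D).
    have := dvdp_sub (dvdp_mull A (introT (dvdp_XnP _ _) PD1)) (dvdp_mull P D1AZ).
    rewrite /B; congr (_ %| _); ring.
  apply: small_polyM; first exact: integral_polyM.
  by move=> j; rewrite -opprB coefN ultrametricN.
have eta0 : eta != 0.
  apply/eqP => eta0; move/eqP: veta.
  by rewrite eta0 ultrametric0 eq_sym oner_eq0.
have vV : v eta^-1 = 1.
  by apply: (mulfI (oner_neq0 R)); rewrite -{1}veta -vM divff // ultrametric1 mulr1.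
have P0 : P.[eta^-1] = 0.
  rewrite /P (big_rem eta) //= hornerM !hornerE mulfV // subrr mul0r //.
(* [P] vanishes at 1/eta, and since |1/eta| = 1 the small polynomial [B] takes a small value
   there. *)
have : v (A.[eta^-1]) < 1.
  have -> : A.[eta^-1] = - B.[eta^-1].
    by rewrite /B hornerD hornerN hornerM P0 mul0r sub0r opprK.
  rewrite ultrametricN horner_coef; apply: ultrametric_sum_lt => // i _.
  by rewrite vM ultrametricX vV expr1n mulr1.
rewrite /A horner_exp !hornerE ultrametricX.
case: (n) => [|k]; first by rewrite expr0 ltxx.
rewrite expr_lt1 // => lt1.
have -> : eta - 1 = eta * (1 - eta^-1) by rewrite mulrBr mulr1 mulfV.
by rewrite vM veta mul1r.
Qed.

End Ultrametric.

(** * Frobenius orbits, and the exponential sums expressed through them *)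

Section FrobeniusOrbits.

Variables (F : finFieldType) (W : fieldExtType F).
Local Notation fW := (finvect_type W).
Local Notation q := #|F|.
Local Notation inW := (map_poly (in_alg fW)).

Definition Frobenius (x : fW) : fW := x ^+ q.

Lemma iter_Frobenius (m : nat) (x : fW) : iter m Frobenius x = x ^+ (q ^ m).
Proof.
elim: m => [|m IH]; first by rewrite expn0 expr1.
by rewrite iterS IH /Frobenius -exprM -expnSr.
Qed.

Lemma Frobenius_inj : injective Frobenius.
Proof.
apply: (can_inj (g := iter (\dim {:W}).-1 Frobenius)) => x.
by rewrite -iterSr prednK ?adim_gt0 // iter_Frobenius -card_finvect expf_card.
Qed.

Lemma Frobenius_rmorphism :
  exists2 alpha : {rmorphism fW -> fW}, alpha =1 Frobenius &
    forall a : F, alpha a%:A = a%:A.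
Proof.
have [alpha _ alphaE] := finField_galois_generator (sub1v {:fW}%AS).
exists (alpha : {rmorphism fW -> fW}) => [x|a].
  by rewrite /= alphaE ?memvf // dimv1 expn1.
by rewrite /= linearZ rmorph1.
Qed.

Lemma horner_Frobenius (g : {poly F}) (x : fW) :
  (inW g).[Frobenius x] = Frobenius (inW g).[x].
Proof.
have [alpha alphaE alphaA] := Frobenius_rmorphism.
rewrite -!alphaE -horner_map -map_poly_comp; congr (_.[_]).
by apply: eq_map_poly => a; rewrite /= alphaA.
Qed.

Lemma Frobenius_fixed (x : fW) : Frobenius x = x -> exists a : F, x = a%:A.
Proof.
move=> /eqP; rewrite /Frobenius => xq.
have : x \in 1%AS by rewrite Fermat's_little_theorem dimv1 expn1.
by case/vlineP => a ->; exists a.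
Qed.

Lemma sum_Frobenius_shift (d : nat) (y : fW) : y ^+ (q ^ d) = y ->
  \sum_(i < d) Frobenius y ^+ (q ^ i) = \sum_(i < d) y ^+ (q ^ i).
Proof.
(* With [y] added, both sides are the sum of y^(q^i) over i <= d, split off at its first or at its
   last term. *)
move=> yd; apply: (addrI y).
have := erefl (\sum_(i < d.+1) y ^+ (q ^ i)); rewrite {1}big_ord_recl big_ord_recr /=.
rewrite expn0 expr1 yd [RHS]addrC => <-; congr (_ + _).
by apply: eq_bigr => i _; rewrite -exprM -expnS.
Qed.

(** The sum is fixed by Frobenius, hence lies in [F], so the default value 0 in [Frobenius_trace]
    does not occur. *)
Lemma Frobenius_traceE (d : nat) (y : fW) : y ^+ (q ^ d) = y ->
  (Frobenius_trace d y)%:A = \sum_(i < d) y ^+ (q ^ i).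
Proof.
move=> yd; rewrite /Frobenius_trace.
case: pickP => [a /eqP //|no_trace].
have [alpha alphaE _] := Frobenius_rmorphism.
have /Frobenius_fixed[a sum_a] :
    Frobenius (\sum_(i < d) y ^+ (q ^ i)) = \sum_(i < d) y ^+ (q ^ i).
  rewrite -alphaE rmorph_sum -[RHS](sum_Frobenius_shift yd).
  by apply: eq_bigr => i _; rewrite rmorphXn /= alphaE.
by have := no_trace a; rewrite sum_a eqxx.
Qed.

Lemma Frobenius_trace_mul (d k : nat) (y : fW) : y ^+ (q ^ d) = y ->
  Frobenius_trace (k * d) y = Frobenius_trace d y *+ k.
Proof.
move=> yd.
have ykd l : y ^+ (q ^ (l * d)) = y by rewrite mulnC expnM expr_iter_fixed.
apply: (fmorph_inj (in_alg fW)); rewrite rmorphMn /= !Frobenius_traceE //.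
elim: k => [|k IH]; first by rewrite big_ord0.
rewrite mulSn big_split_ord /= mulrS -IH; congr (_ + _).
by apply: eq_bigr => i _; rewrite expnD exprM yd.
Qed.

Lemma Frobenius_trace_Frobenius (d : nat) (y : fW) : y ^+ (q ^ d) = y ->
  Frobenius_trace d (Frobenius y) = Frobenius_trace d y.
Proof.
move=> yd; apply: (fmorph_inj (in_alg fW)); rewrite /= !Frobenius_traceE //.
  exact: sum_Frobenius_shift.
by rewrite /Frobenius -exprM mulnC exprM yd.
Qed.

Variables (K : fieldType) (psi : F -> K) (f g : {poly F}).
Hypothesis psi_char : additive_character psi.

Lemma additive_characterMn (a : F) (k : nat) : psi (a *+ k) = psi a ^+ k.
Proof.
have [psi0 psiD] := psi_char.
by elim: k => [|k IH]; rewrite ?mulr0n // mulrS psiD IH exprS.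
Qed.

(** The constant c_O of the orbit O of [x]; the orbit length is the degree of [x] over [F]. *)
Definition orbit_value (x : fW) : K :=
  psi (Frobenius_trace (fingraph.order Frobenius x) ((inW f).[x] / (inW g).[x])).

Lemma order_Frobenius (x : fW) :
  fingraph.order Frobenius (Frobenius x) = fingraph.order Frobenius x.
Proof.
by apply/eq_card => y; rewrite -!topredE /= -(same_fconnect1 Frobenius_inj).
Qed.

Let quotient_fixed (m : nat) (x : fW) : x ^+ (q ^ m) = x ->
  ((inW f).[x] / (inW g).[x]) ^+ (q ^ m) = (inW f).[x] / (inW g).[x].
Proof.
rewrite expr_div_n -!iter_Frobenius => xm.
have iter_horner (u : {poly F}) :
    iter m Frobenius (inW u).[x] = (inW u).[iter m Frobenius x].
  by elim: (m) => [|l IH] //=; rewrite horner_Frobenius IH.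
by rewrite !iter_horner xm.
Qed.

Let fixed_order (x : fW) : x ^+ (q ^ fingraph.order Frobenius x) = x.
Proof. by rewrite -iter_Frobenius (iter_order Frobenius_inj). Qed.

Lemma orbit_value_Frobenius (x : fW) : orbit_value (Frobenius x) = orbit_value x.
Proof.
rewrite /orbit_value order_Frobenius !horner_Frobenius.
have -> : Frobenius (inW f).[x] / Frobenius (inW g).[x] =
    Frobenius ((inW f).[x] / (inW g).[x]) by rewrite /Frobenius expr_div_n.
by rewrite Frobenius_trace_Frobenius // quotient_fixed.
Qed.

(** For a point of degree d dividing m, the trace from degree m is m/d times the trace from degree
    d; [psi] turns this multiple into a power. *)
Lemma exp_sum_orbits (E : fieldExtType F) : (\dim {:E} %| \dim {:W})%N ->
  exp_sum E psi f g =
  \sum_(x : fW | (iter (\dim {:E}) Frobenius x == x) && ((inW g).[x] != 0))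
     orbit_value x ^+ (\dim {:E} %/ fingraph.order Frobenius x).
Proof.
move=> dimE; rewrite (exp_sum_embedding psi f g dimE).
apply: eq_big => [x|x /andP[/eqP xm _]]; first by rewrite iter_Frobenius.
rewrite -additive_characterMn -Frobenius_trace_mul ?quotient_fixed //.
by rewrite divnK // -(iter_fixed_order Frobenius_inj) iter_Frobenius xm.
Qed.

(** The point count of the punctured line: every root of [g] is rational, so each extension loses
    the same number of points. *)
Lemma count_fixed_points (E : fieldExtType F) :
  (\dim {:E} %| \dim {:W})%N ->
  (forall x : fW, root (inW g) x -> Frobenius x = x) ->
  \sum_(x : fW | (iter (\dim {:E}) Frobenius x == x) && ((inW g).[x] != 0)) 1 =
  q%:R ^+ \dim {:E} - #|[pred x : fW | root (inW g) x]|%:R :> K.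
Proof.
move=> dimE g_fixed; have [theta _] := finfield_embedding dimE.
have := sum_embedding (fun _ => 1 : K) theta.
rewrite sumr_const card_finvect natrX => ->.
rewrite [in RHS](bigID (fun x : fW => (inW g).[x] == 0)) /=.
rewrite [X in _ = X + _ - _](_ : _ = #|[pred x : fW | root (inW g) x]|%:R).
  rewrite addrAC subrr add0r; apply: eq_bigl => x.
  by rewrite iter_Frobenius.
rewrite -sumr_const; apply: eq_bigl => x; rewrite inE -rootE; apply: andb_idl => gx.
rewrite -iter_Frobenius; apply/eqP.
by elim: (\dim _) => //= m ->; exact: g_fixed.
Qed.

End FrobeniusOrbits.

(** * The p-adic data, and assembly of the proof *)

Lemma padic_abs_nat (R : realType) (p k : nat) :
  padic_abs R p k.+1%:R = (p%:R ^+ logn p k.+1)^-1.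
Proof.
rewrite /padic_abs pnatr_eq0 /= -[k.+1%:R]/(k.+1%:~R) numq_int denq_int.
by rewrite logn1 expr0 mul1r.
Qed.

(** Splitting over [F] itself carries over to every extension of [F], whereas the hypothesis only
    concerns the closure. *)
Lemma roots_in_subfield (F : fieldType) (C : closedFieldType)
    (iota : {rmorphism F -> C}) (g : {poly F}) :
  (forall a, root (map_poly iota g) a -> exists b, a = iota b) ->
  exists rs : seq F, g = lead_coef g *: \prod_(b <- rs) ('X - b%:P).
Proof.
move=> g_roots; have [rs gE] := closed_field_poly_normal (map_poly iota g).
have [rs' rsE] : exists rs', rs = map iota rs'.
  have : forall a, a \in rs -> exists b, a = iota b.
    move=> a ars; apply: g_roots.
    by rewrite gE rootE hornerZ (rootP _) ?mulr0 // root_prod_XsubC.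
  elim: (rs) => [|a r IH] rb; first by exists [::].
  have [b ->] := rb a (mem_head _ _).
  have [a' ar|r' ->] := IH; first by apply: rb; rewrite inE ar orbT.
  by exists (b :: r').
exists rs'; apply: (map_poly_inj iota); rewrite {1}gE rsE big_map lead_coef_map.
rewrite map_polyZ rmorph_prod; congr (_ *: _); apply: eq_bigr => b _.
by rewrite rmorphB /= map_polyX map_polyC.
Qed.

Theorem theorem1
  (R : realType) (p : nat)
  (* the finite field, an algebraic closure of it, and its finite extensions *)
  (F : finFieldType) (charF : p \in [pchar F])
  (Fbar : closedFieldType) (iota : {rmorphism F -> Fbar})
  (Fbar_alg : forall x : Fbar, algebraicOver iota x)
  (E : nat -> fieldExtType F)
  (dimE : forall m : nat, (0 < m)%N -> \dim {:E m} = m)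
  (* the p-adic numbers, an algebraic closure and the extended absolute value *)
  (Qp : fieldType) (absQp : Qp -> R) (Qp_padic : is_padic_field p absQp)
  (Qpbar : closedFieldType) (j : {rmorphism Qp -> Qpbar})
  (Qpbar_alg : forall x : Qpbar, algebraicOver j x)
  (absp : Qpbar -> R) (absp_abs : ultrametric_abs absp)
  (absp_ext : forall x : Qp, absp (j x) = absQp x)
  (* the additive character *)
  (zeta : Qpbar) (zeta_prim : p.-primitive_root zeta)
  (psi : F -> Qpbar) (psi_char : additive_character psi)
  (psi_nontriv : exists x : F, psi x != 1)
  (psi_Qzeta : forall x : F,
     exists r : {poly rat}, psi x = (map_poly ratr r).[zeta])
  (* the rational function f / g *)
  (f g : {poly F}) (g_neq0 : g != 0) (fg_coprime : coprimep f g)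
  (pole_at_0 : root g 0) (pole_at_infty : (size g < size f)%N)
  (pole_orders : forall a : Fbar,
     let d := pole_order (map_poly iota f) (map_poly iota g) a in
     (0 < d)%N -> ~~ (p %| d)%N)
  (pole_order_at_infty : ~~ (p %| pole_order_infty f g)%N)
  (n : nat) (n_def : n = num_roots (map_poly iota g))
  (p_gt_n : (n < p)%N)
  (g_roots : forall a : Fbar,
     root (map_poly iota g) a -> exists b : F, a = iota b) :
  forall eta : Qpbar,
    reciprocal_root (Lfun E psi f g) eta ->
    absp eta = 1 -> absp (eta - 1) < 1.
Proof.
move=> eta [s [_ LE eta_s]] veta.
have p_pr : prime p := pcharf_prime charF.
have abs_nat k : absp k.+1%:R = (p%:R ^+ logn p k.+1)^-1.
  case: Qp_padic => _ abs_rat _ _.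
  by rewrite -(rmorph_nat j) absp_ext -(ratr_nat Qp) abs_rat padic_abs_nat.
have vp : absp p%:R < 1.
  rewrite -(prednK (prime_gt0 p_pr)) abs_nat prednK ?prime_gt0 //.
  by rewrite logn_prime // eqxx expr1 invf_lt1 ?ltr0n ?ltr1n ?prime_gt0 ?prime_gt1.
have char0 k : k.+1%:R != 0 :> Qpbar.
  apply/eqP => k0; have := abs_nat k; rewrite k0 ultrametric0 // => /esym/eqP.
  by rewrite invr_eq0 expf_eq0 pnatr_eq0 (gtn_eqF (prime_gt0 p_pr)) andbF.
(* psi(a)^p = psi(p a) = psi(0) = 1. *)
have psi1 a : absp (psi a - 1) < 1.
  apply: (root_unity_one_unit absp_abs p_pr vp).
  by rewrite -additive_characterMn // mulrn_pchar //; case: psi_char.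
have [rs gE] := roots_in_subfield g_roots.
(* [N] exceeds the degree of the L-function and bounds the number of roots of [g]. *)
pose N := maxn (size s).+1 (size g).
have dimW : \dim {:E N`!} = N`! by rewrite dimE ?fact_gt0.
have dvdW m : (0 < m <= N)%N -> (\dim {:E m} %| \dim {:E N`!})%N.
  by move=> /andP[m0 mN]; rewrite dimW dimE // dvdn_fact // m0.
pose W := finvect_type (E N`!); pose gW := map_poly (in_alg W) g.
have g_fixed (x : W) : root gW x -> Frobenius x = x.
  rewrite /gW gE map_polyZ rmorph_prod rootZ ?fmorph_eq0 ?lead_coef_eq0 //.
  rewrite (eq_bigr (fun b => 'X - (in_alg W b)%:P)) => [|b _]; last first.
    by rewrite rmorphB /= map_polyX map_polyC.
  rewrite -(big_map (in_alg W) xpredT (fun x => 'X - x%:P)) root_prod_XsubC.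
  by case/mapP => b _ ->; rewrite /Frobenius -rmorphXn expf_card.
pose A := fun x : W => gW.[x] != 0.
have A_phi x : A (Frobenius x) = A x.
  by rewrite /A horner_Frobenius /Frobenius expf_eq0 (ltnW (finNzRing_gt1 F)).
pose c := orbit_value psi f g : W -> Qpbar.
have c_phi x : c (Frobenius x) = c x by exact: orbit_value_Frobenius.
pose D := orbit_prod (@Frobenius F (E N`!)) A c.
pose D1 := orbit_prod (@Frobenius F (E N`!)) A (fun _ => 1 : Qpbar).
(* The number of punctures, counted inside [W]. *)
pose n0 := #|[pred x : W | root gW x]|.
have n0N : (n0 <= N)%N.
  rewrite (leq_trans _ (leq_maxr _ _)) // -(size_map_poly (in_alg W)) ltnW //.
  rewrite /n0 cardE; apply: max_poly_roots; rewrite ?enum_uniq ?map_poly_eq0 //.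
  by apply/allP => x; rewrite mem_enum.
have DN := log_deriv_orbit_prod (@Frobenius_inj F (E N`!)) A_phi c_phi N.
have D1N := log_deriv_orbit_prod (@Frobenius_inj F (E N`!)) A_phi
  (c := fun _ => 1 : Qpbar) (fun _ => erefl) N.
have [iD _ sD] :
    [/\ integral_poly absp D, integral_poly absp D1 & small_poly absp (D - D1)].
  apply: (small_poly_prodB absp_abs) => x _.
  have c1 : absp (c x - 1) < 1 by exact: psi1.
  have vc : absp (c x) <= 1.
    by rewrite -[c x](subrK 1) (ultrametricD_le absp_abs) ?(ultrametric1 absp_abs) // ltW.
  split; try exact: (integral_1subXn absp_abs).
    by apply: (integral_1subXn absp_abs); rewrite (ultrametric1 absp_abs).
  move=> i; rewrite opprB addrC addrA subrK -scalerBl coefZ coefXn.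
  have [abs_ge0 _ -> _] := absp_abs; apply: le_lt_trans c1.
  rewrite -opprB (ultrametricN absp_abs) ler_piMr //.
  exact: ultrametric_nat_le1.
apply: (reciprocal_root_one_unit (q := #|F|) absp_abs iD sD _
  (leq_maxl _ _) n0N _ _ eta_s veta).
- by case: DN.
(* The logarithmic derivatives of L and [D] are opposite, so L D = 1 modulo X^(N+1). *)
- apply: (log_deriv_uniq char0 _ (log_deriv1 _ N)).
  apply: eq_log_deriv (log_derivM (log_deriv_fps_exp char0 N (fun i => esym (LE i))) DN).
  move=> m mN /=; have m0 : (0 < m)%N by case/andP: mN.
  have := exp_sum_orbits f g psi_char (dvdW m mN); rewrite (dimE m m0) => ->.
  exact: subrr.
(* In degree m, [D1] contributes -(q^m - n0) and (1 - X)^n0 contributes -n0; the total -q^m belongs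
   to 1 - q X. *)
- apply: (log_deriv_uniq char0 _ (log_deriv_1subXn N #|F|%:R (ltn0Sn 0))).
  have lin := log_deriv_1subXn N (1 : Qpbar) (ltn0Sn 0); rewrite scale1r in lin.
  have := log_deriv_prod (index_enum 'I_n0) (P := xpredT) (fun i _ => lin).
  rewrite prodr_const card_ord => linn.
  apply: eq_log_deriv (log_derivM D1N linn) => m mN /=.
  have m0 : (0 < m)%N by case/andP: mN.
  have := count_fixed_points Qpbar (dvdW m mN) g_fixed; rewrite dimE //.
  under eq_bigr do rewrite expr1n.
  move=> ->; rewrite sumr_const card_ord dvd1n divn1 expr1n mulr1n.
  rewrite opprB mulNrn addrAC subrr add0r //.
Qed.
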